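(* Let $d\geq 5$. There exists a function $\delta:(0,\infty)\to(0,\infty)$, depending only on $d$ (so that $\delta(\gamma)$ is a positive constant depending only on $d$ and $\gamma$), with $\delta(\gamma)\to 0$ as $\gamma\to+\infty$, such that the following holds for every $\gamma>0$ and every law $\mathbb{Q}$ of i.i.d. random conductances on the nearest-neighbor bonds of $\mathbb{Z}^d$ with values in $(0,1]$ satisfying $\mathbb{Q}(\omega_b\leq a)\sim a^{\gamma}$ as $a\downarrow 0$: for $\mathbb{Q}$-almost every $\omega$, $$\limsup_{n\to+\infty}\ \sup_{x\in\mathbb{Z}^d}\frac{\log P_\omega^{n}(0,x)}{\log n}\leq -\frac{d}{2}+\delta(\gamma).$$
   Context: Write $x\sim y$ if $x,y\in\mathbb{Z}^d$ are nearest neighbors. An environment is a family $\omega=(\omega_{xy})_{x,y\in\mathbb{Z}^d}$ of nonnegative numbers (conductances) with $\omega_{xy}=\omega_{yx}$ and $\omega_{xy}>0$ if and only if $x\sim y$; for an unordered nearest-neighbor pair (bond) $b=\{x,y\}$ write $\omega_b=\omega_{xy}$. Under the probability measure $\mathbb{Q}$ the family $(\omega_b)$, $b$ ranging over the bonds of $\mathbb{Z}^d$, is i.i.d. The notation $\mathbb{Q}(\omega_b\le a)\sim a^\gamma$ as $a\downarrow 0$ means that the ratio of the two sides tends to $1$. Given $\omega$, let $\pi_\omega(x)=\sum_{y}\omega_{xy}$ and let $P_\omega(x,y)=\omega_{xy}/\pi_\omega(x)$ be the transition matrix of the discrete-time random walk in the environment $\omega$; $P_\omega^n(x,y)$ denotes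 its $n$-step transition probability. Convention: $\log 0=-\infty$. *)

(* Defs.v *)
From HB Require Import structures.
From mathcomp Require Import all_boot all_order all_algebra finmap.
From mathcomp Require Import all_classical all_reals all_analysis.

Set Implicit Arguments.
Unset Strict Implicit.
Unset Printing Implicit Defensive.
Import Order.TTheory GRing.Theory Num.Theory.
Import numFieldNormedType.Exports.

Local Open Scope classical_set_scope.
Local Open Scope ring_scope.

Definition site (d : nat) := 'rV[int]_d.

Definition neighbors (d : nat) (x y : site d) : bool :=
  \sum_(i < d) `|x ord0 i - y ord0 i| == 1.

(* (x, i) stands for the unordered nearest-neighbor pair {x, x + e_i}; see
   [neighbors_bond] below: this enumerates every unordered pair exactly once. *)
Definition bond (d : nat) := (site d * 'I_d)%type.

Definition bond_src (d : nat) (b : bond d) : site d := b.1.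
Definition bond_tgt (d : nat) (b : bond d) : site d := b.1 + delta_mx ord0 b.2.

Definition environment (R : realType) (d : nat) (w : site d -> site d -> R) :=
  [/\ forall x y, 0 <= w x y,
      forall x y, w x y = w y x &
      forall x y, 0 < w x y <-> neighbors x y].

(* The sums over all of Z^d below are finitely supported sums (fsbigop): in an
   environment only the 2d neighbors of x contribute a nonzero term. *)
Definition total_conductance (R : realType) (d : nat)
    (w : site d -> site d -> R) (x : site d) : R :=
  \sum_(y \in [set: site d]) w x y.

Definition transition (R : realType) (d : nat) (w : site d -> site d -> R)
    (x y : site d) : R :=
  w x y / total_conductance w x.

Fixpoint transition_n (R : realType) (d : nat) (w : site d -> site d -> R)
    (n : nat) (x y : site d) : R :=
  if n is m.+1 then
    \sum_(z \in [set: site d]) transition w x z * transition_n w m z y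
  else (x == y)%:R.

Section IID.
Context (disp : measure_display) (T : measurableType disp) (R : realType)
  (Q : probability T R) (I : choiceType).

Definition mutually_independent (X : I -> {RV Q >-> R}) : Prop :=
  forall (J : {fset I}) (B : I -> set R),
    (forall i, i \in J -> measurable (B i)) ->
    Q (\bigcap_(i in [set i | i \in J]) (X i @^-1` B i)) =
    (\prod_(i <- J) Q (X i @^-1` B i))%E.

Definition identically_distributed (X : I -> {RV Q >-> R}) : Prop :=
  forall (i j : I) (A : set R), measurable A ->
    distribution Q (X i) A = distribution Q (X j) A.

Definition iid (X : I -> {RV Q >-> R}) : Prop :=
  mutually_independent X /\ identically_distributed X.

End IID.

Lemma neighbors_sym (d : nat) (x y : site d) : neighbors x y = neighbors y x.
Proof. by rewrite /neighbors; under eq_bigr do rewrite distrC. Qed.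

Lemma bond_neighbors (d : nat) (b : bond d) :
  neighbors (bond_src b) (bond_tgt b).
Proof.
rewrite /neighbors (bigD1 b.2)//= big1 ?addr0 => [|i /negPf ib].
  by rewrite !mxE !eqxx opprD addNKr.
by rewrite !mxE ib eqxx/= addr0 subrr.
Qed.

Lemma neighbors_bond (d : nat) (x y : site d) : neighbors x y ->
  exists! b : bond d, (bond_src b, bond_tgt b) \in [:: (x, y); (y, x)].
Proof.
have aux (x' y' : site d) : neighbors x' y' ->
    exists i, y' = x' + delta_mx ord0 i \/ x' = y' + delta_mx ord0 i.
  move=> nxy; have [i xyi] : exists i, x' ord0 i != y' ord0 i.
    apply/existsP; apply: contraLR nxy; rewrite negb_exists => /forallP h.
    rewrite /neighbors big1// => i _.
    by move: (h i); rewrite negbK => /eqP ->; rewrite subrr normr0.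
  move: nxy; rewrite /neighbors (bigD1 i)//= => /eqP nxy.
  have s0 : 0 <= \sum_(j < d | j != i) `|x' ord0 j - y' ord0 j|.
    exact: sumr_ge0.
  have a1 : 1 <= `|x' ord0 i - y' ord0 i|.
    by rewrite -gtz0_ge1 normr_gt0 subr_eq0.
  have e0 : \sum_(j < d | j != i) `|x' ord0 j - y' ord0 j| = 0.
    apply/eqP; rewrite eq_le s0 andbT.
    by rewrite -(lerD2l `|x' ord0 i - y' ord0 i|) nxy addr0.
  have e1 : `|x' ord0 i - y' ord0 i| = 1 by rewrite -nxy e0 addr0.
  have eqj j : j != i -> x' ord0 j = y' ord0 j.
    move=> ji; apply/eqP; rewrite -subr_eq0 -normr_eq0.
    by apply/eqP; move/psumr_eq0P : e0; apply.
  exists i; move/eqP: e1; rewrite eqr_norml ler01 andbT => /orP[/eqP e|/eqP e].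
  - right; apply/rowP => j; rewrite !mxE eqxx/=.
    have [->|/eqj ->] := eqVneq j i; last by rewrite addr0.
    by rewrite -e addrC subrK.
  - left; apply/rowP => j; rewrite !mxE eqxx/=.
    have [->|/eqj ->] := eqVneq j i; last by rewrite addr0.
    by rewrite -(opprK 1) -e opprB addrC subrK.
have inj (x' : site d) (i j : 'I_d) :
    x' + delta_mx ord0 i = x' + delta_mx ord0 j -> i = j.
  move=> /addrI /rowP /(_ i); rewrite !mxE !eqxx/=.
  by case: eqVneq.
have asym (x' : site d) (i j : 'I_d) :
    x' <> x' + delta_mx ord0 i + delta_mx ord0 j.
  move=> /rowP /(_ i); rewrite !mxE !eqxx/= -addrA => /eqP.
  by rewrite -subr_eq0 opprD addNKr; case: (i == j).
move=> /aux[i [ey|ex]]; [exists (x, i)|exists (y, i)];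
  (split; first by rewrite /bond_src/bond_tgt/= ?ey ?ex !inE eqxx ?orbT);
  move=> [z j]; rewrite !inE /bond_src/bond_tgt/= => /orP[] /eqP[-> h].
- by rewrite ey in h; rewrite (inj _ _ _ h).
- by case: (asym x i j); rewrite -ey.
- by case: (asym y i j); rewrite -ex.
- by rewrite ex in h; rewrite (inj _ _ _ h).
Qed.

(* Main.v *)
Require Import Defs.
From HB Require Import structures.
From mathcomp Require Import all_boot all_order all_algebra finmap.
From mathcomp Require Import all_classical all_reals all_analysis.
From mathcomp Require Import ring lra zify.

(** On a box of side of order n there are polynomially many bonds, and a bond
    is below n^-eps with probability about n^-(eps gamma).  With
    eps = (d + 2) / gamma the union bound is summable, so by Borel-Cantelli
    almost surely, for all large n, every conductance that the walk can meet
    during its first n steps lies in [n^-eps, 1]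
    ([eventually_no_low_conductance]).  Raising the other conductances to
    n^-eps changes nothing for these n steps ([transition_n_local]), so it is
    enough to bound the heat kernel of an environment with values in [lam, 1],
    losing only a power of lam^-1 which depends on d.  As lam = n^-eps, the
    loss is a power of n whose exponent is a multiple of eps, hence O(1/gamma).

    For such an environment let pi be the total conductance and
    g_n(x) = P^n(x, y) / pi(y), so that g_(n+1) = P g_n and g_n has
    pi-mass 1.  Going from g to P g decreases the squared norm in l^2(pi) by a
    sum of variances, one for each site z, of the values of g at the neighbors
    of z.  Keeping only the pairs of opposite neighbors gives a drop of at least
    lam^2 / (2d) times the energy of g along the increments 2 e_i
    ([energy_drop]).  As these increments have even length, they
    connect sites of equal parity, and the periodicity of the walk does no harm.

    The energy is bounded below by a Nash-type inequality ([box_nash]): for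
    f >= 0 and a box of side r,
      |f|_2^2 <= r^-d |f|_1^2 + (d r)^2 / 2 * energy(f).
    It follows by averaging the identity
      |f|_2^2 = sum_x f(x) f(x + v) + 1/2 sum_x (f(x + v) - f(x))^2
    over the r^d vectors v with even coordinates 2 v_i, 0 <= v_i < r: the first
    term sums over v to at most |f|_1^2, and the second is at most (d r)^2 / 2
    times the energy since v is a sum of at most d r vectors 2 e_i.  For a fixed r this yields the affine
    recursion u_(n+1) - A <= (1 - 1/K) (u_n - A) for u_n = |g_n|_2^2, with A of
    order r^-d and K of order r^2 up to powers of lam
    ([sq_norm_contraction]).

    A single scale is enough since a factor n^O(eps) may be lost: with
    r = n^(1/2 - 2 eps) the contraction factor over n/2 steps is at most
    exp(- c n^(2 eps)), so u_n is at most n^(-d/2 + O(eps)) ([scale_bound]).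
    Self-adjointness of P turns this into a bound on P^n(x, y) for all x, y
    and n ([heat_density_pairing]).  When 4 eps > 1 the choice
    delta(gamma) = (2d + 3) eps makes the right-hand side nonnegative, and
    P^n <= 1 suffices. *)

Set Implicit Arguments.
Unset Strict Implicit.
Unset Printing Implicit Defensive.
Import Order.TTheory GRing.Theory Num.Theory.
Import numFieldNormedType.Exports.

Local Open Scope classical_set_scope.
Local Open Scope ring_scope.

(** * Sums of finitely supported functions on a lattice *)

(** The sum over all of V of a function of infinite support is 0 by convention,
    so additivity and monotonicity of sums may fail without this predicate. *)
Definition fsupp (R : realType) (V : zmodType) (f : V -> R) :=
  finite_set [set x | f x != 0].

Local Notation lsum f := (\sum_(x \in setT) f x).

Section FiniteSupport.
Context (R : realType) (V : zmodType).
Implicit Types f g : V -> R.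

Lemma fsuppP f :
  fsupp f <-> exists A : {fset V}, forall x, x \notin A -> f x = 0.
Proof.
split=> [fF|[A fA]].
  exists (fset_set [set x | f x != 0]) => x; rewrite in_fset_set// notin_setE/=.
  by move/negP; rewrite negbK => /eqP.
apply: (sub_finite_set _ (finite_fset A)) => x /= fx0.
by apply: contraNT fx0 => /fA ->.
Qed.

Lemma sub_fsupp f g : (forall x, f x = 0 -> g x = 0) -> fsupp f -> fsupp g.
Proof.
move=> fg; apply: sub_finite_set => x /=; apply: contra_neq; exact: fg.
Qed.

Lemma fsuppD f g : fsupp f -> fsupp g -> fsupp (fun x => f x + g x).
Proof.
move=> fF gF.
apply: (sub_finite_set (B := [set x | f x != 0] `|` [set x | g x != 0])).
  move=> x /= h; apply: contrapT => /not_orP[] /negP; rewrite negbK => /eqP fx.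
  by move=> /negP; rewrite negbK => /eqP gx; move: h; rewrite fx gx addr0 eqxx.
by rewrite finite_setU.
Qed.

Lemma fsuppMl f g : fsupp f -> fsupp (fun x => g x * f x).
Proof. by apply: sub_fsupp => x ->; rewrite mulr0. Qed.

Lemma fsuppMr f g : fsupp f -> fsupp (fun x => f x * g x).
Proof. by apply: sub_fsupp => x ->; rewrite mul0r. Qed.

Lemma fsupp_sum (I : Type) (r : seq I) (F : I -> V -> R) :
  (forall i, fsupp (F i)) -> fsupp (fun x => \sum_(i <- r) F i x).
Proof.
move=> Ff; elim: r => [|i r IH].
  apply: (@sub_finite_set _ _ set0) => // x /=.
  by rewrite big_nil eqxx.
apply: (@sub_fsupp (fun x => F i x + \sum_(i <- r) F i x)); last exact: fsuppD.
by move=> x; rewrite big_cons.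
Qed.

Lemma fsupp_shift f v : fsupp f -> fsupp (fun x => f (x + v)).
Proof.
move=> fF.
apply: (sub_finite_set (B := (fun x => x - v) @` [set x | f x != 0])).
  by move=> x /= h; exists (x + v) => //; rewrite addrK.
exact: finite_image.
Qed.

Lemma lsum_shift f v : lsum (fun x => f (x + v)) = lsum f.
Proof.
rewrite [RHS](reindex_fsbigT (fun x => x + v))//.
by exists (fun x => x - v) => x; rewrite ?addrK ?subrK.
Qed.

Lemma lsumD f g : fsupp f -> fsupp g ->
  lsum (fun x => f x + g x) = lsum f + lsum g.
Proof.
move=> /fsuppP[A fA] /fsuppP[B gB].
rewrite !(fsbigTE (A `|` B)%fset) ?big_split// => x;
  rewrite in_fsetU negb_or => /andP[xA xB].
- exact: gB.
- exact: fA.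
- by rewrite fA// gB// addr0.
Qed.

Lemma lsumZ a f : lsum (fun x => a * f x) = a * lsum f.
Proof. by rewrite mulr_fsumr. Qed.

Lemma lsum_sum (I : Type) (r : seq I) (F : I -> V -> R) :
  (forall i, fsupp (F i)) ->
  lsum (fun x => \sum_(i <- r) F i x) = \sum_(i <- r) lsum (F i).
Proof.
move=> Ff; elim: r => [|i r IH].
  by rewrite big_nil fsbig1// => x _; rewrite big_nil.
under eq_fsbigr do rewrite big_cons.
by rewrite lsumD// ?big_cons ?IH//; exact: fsupp_sum.
Qed.

Lemma ler_lsum f g : fsupp f -> fsupp g -> (forall x, f x <= g x) ->
  lsum f <= lsum g.
Proof.
move=> /fsuppP[A fA] /fsuppP[B gB] fg.
rewrite !(fsbigTE (A `|` B)%fset) ?ler_sum// => x;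
  rewrite in_fsetU negb_or => /andP[xA xB].
- exact: gB.
- exact: fA.
Qed.

Lemma ler_lsum_inj (I : finType) (h : I -> V) f : injective h ->
  fsupp f -> (forall x, 0 <= f x) -> \sum_i f (h i) <= lsum f.
Proof.
move=> hI fF f0; have [A fA] := (fsuppP f).1 fF.
have -> : \sum_i f (h i) = \sum_(x <- map h (enum I)) f x.
  by rewrite big_map big_enum.
rewrite (fsbigTE (A `|` [fset x | x in map h (enum I)])%fset); last first.
  by move=> x; rewrite in_fsetU negb_or => /andP[xA _]; exact: fA.
rewrite (big_fsetID _ (mem (map h (enum I))))/=.
rewrite -[leLHS]addr0 lerD ?sumr_ge0// le_eqVlt; apply/orP; left; apply/eqP.
apply: perm_big; apply: uniq_perm;
  rewrite ?map_inj_uniq -?enumT ?enum_uniq ?fset_uniq//.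
move=> x; rewrite !inE/=; case: (x \in map h (enum I)) => //=.
  by rewrite orbT.
by rewrite orbF andbF.
Qed.

End FiniteSupport.

(** * A Nash-type inequality at a fixed scale *)

Section Nash.
Context (R : realType) (V : zmodType).
Implicit Types f : V -> R.

Definition incr_energy f (v : V) : R := lsum (fun x => (f (x + v) - f x) ^+ 2).

Lemma fsupp_incr f v : fsupp f -> fsupp (fun x => (f (x + v) - f x) ^+ 2).
Proof.
move=> fF; apply: (@sub_fsupp _ _ (fun x => f (x + v) - f x)).
  by move=> x ->; rewrite expr0n.
apply: fsuppD; first exact: fsupp_shift.
by apply: sub_fsupp fF => x ->; rewrite oppr0.
Qed.

Lemma incr_energy_ge0 f v : 0 <= incr_energy f v.
Proof. by apply: fsumr_ge0 => x _; exact: sqr_ge0. Qed.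

(** The square root of the energy is a seminorm of the increment, hence
    subadditive.  To avoid square roots, Minkowski's inequality is replaced by
    (a + b)^2 <= (1 + 1/N) a^2 + (1 + N) b^2, with equality for a = N b, the
    case of N + 1 equal steps. *)
Lemma incr_energy_sum f (G : R) (s : seq V) : fsupp f -> 0 <= G ->
  (forall v, v \in s -> incr_energy f v <= G) ->
  incr_energy f (\sum_(v <- s) v) <= (size s)%:R ^+ 2 * G.
Proof.
move=> fF G0; elim: s => [|v s IH] sG.
  rewrite big_nil /incr_energy fsbig1 ?mulr_ge0// => x _.
  by rewrite addr0 subrr expr0n.
have vG : incr_energy f v <= G by apply: sG; rewrite mem_head.
have {}IH : incr_energy f (\sum_(v <- s) v) <= (size s)%:R ^+ 2 * G.
  by apply: IH => u us; apply: sG; rewrite in_cons us orbT.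
case: s IH {sG} => [|w s]; first by rewrite big_seq1 expr1n mul1r.
rewrite (big_cons _ _ v); move: (\sum_(_ <- _) _) => u.
have -> : size [:: v, w & s] = (size (w :: s)).+1 by [].
move: (size (w :: s)) (isT : (0 < size (w :: s))%N) => n n0 uG.
rewrite -natr1.
have {}n0 : 0 < n%:R :> R by rewrite ltr0n.
set N : R := n%:R in n0 uG *.
have e1 : incr_energy f u = lsum (fun x => (f (x + v + u) - f (x + v)) ^+ 2).
  by rewrite /incr_energy -(lsum_shift _ v).
apply: (@le_trans _ _ ((1 + N^-1) * incr_energy f u
    + (1 + N) * incr_energy f v)).
  rewrite e1 /incr_energy -!lsumZ -lsumD; last 2 first.
  - by apply: fsuppMl; exact: (fsupp_shift v (fsupp_incr u fF)).
  - by apply: fsuppMl; exact: fsupp_incr.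
  apply: ler_lsum => [||x].
  - exact: fsupp_incr.
  - apply: fsuppD; apply: fsuppMl; last exact: fsupp_incr.
    exact: (fsupp_shift v (fsupp_incr u fF)).
  - rewrite (addrA x).
    set a := f (x + v + u) - f (x + v); set b := f (x + v) - f x.
    have -> : f (x + v + u) - f x = a + b by rewrite /a /b; ring.
    rewrite -subr_ge0.
    have -> : (1 + N^-1) * a ^+ 2 + (1 + N) * b ^+ 2 - (a + b) ^+ 2 =
      N^-1 * (a - N * b) ^+ 2 by field; rewrite gt_eqF.
    by rewrite mulr_ge0 ?sqr_ge0// invr_ge0 ltW.
have -> : (N + 1) ^+ 2 * G = (1 + N^-1) * (N ^+ 2 * G) + (1 + N) * G.
  by field; rewrite gt_eqF.
by rewrite lerD// ler_wpM2l// addr_ge0// ?invr_ge0 ltW.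
Qed.

Definition box_point d r (e : 'I_d -> V) (v : {ffun 'I_d -> 'I_r}) : V :=
  \sum_i e i *+ v i.

Lemma incr_energy_box f d r (e : 'I_d -> V) (v : {ffun 'I_d -> 'I_r}) :
  fsupp f ->
  incr_energy f (box_point e v) <= (d * r)%:R ^+ 2 * \sum_i incr_energy f (e i).
Proof.
move=> fF.
pose s := flatten [seq nseq (v i) (e i) | i <- enum 'I_d].
have G0 : 0 <= \sum_i incr_energy f (e i).
  by apply: sumr_ge0 => i _; exact: incr_energy_ge0.
have -> : box_point e v = \sum_(w <- s) w.
  rewrite big_flatten big_map /box_point big_enum/=.
  by apply: eq_bigr => i _; rewrite big_nseq -Monoid.iteropE.
apply: (@le_trans _ _ ((size s)%:R ^+ 2 * \sum_i incr_energy f (e i))).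
  apply: incr_energy_sum => // w /flattenP[t /mapP[i _ ->]].
  rewrite mem_nseq => /andP[_ /eqP ->].
  rewrite (bigD1 i)//= lerDl; apply: sumr_ge0 => j _; exact: incr_energy_ge0.
rewrite ler_wpM2r// ler_pXn2r ?nnegrE// ler_nat.
rewrite size_flatten /shape -map_comp sumnE big_map big_enum/=.
rewrite (@leq_trans (\sum_(i < d) r)%N)//.
  by apply: leq_sum => i _; rewrite size_nseq ltnW.
by rewrite sum_nat_const card_ord.
Qed.

(** Averaging over the box replaces f by its local mean, whose supremum is at
    most r^-d |f|_1; the error is the mean energy of the increments of the box.
    Injectivity of the parametrization says that the box has r^d points. *)
Lemma box_nash f d r (e : 'I_d -> V) : fsupp f -> (forall x, 0 <= f x) ->
  injective (@box_point d r.+1 e) ->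
  lsum (fun x => f x ^+ 2) <= (r.+1%:R ^+ d)^-1 * lsum f ^+ 2
    + (d * r.+1)%:R ^+ 2 / 2 * \sum_i incr_energy f (e i).
Proof.
move=> fF f0 eI; set G := \sum_i _.
set N : R := r.+1%:R ^+ d.
have N0 : 0 < N by rewrite exprn_gt0.
have ffF : fsupp (fun x => f x ^+ 2) by exact: fsuppMr.
have N1 : 0 <= N^-1 by rewrite invr_ge0 ltW.
have cardN : #|{ffun 'I_d -> 'I_r.+1}|%:R = N.
  by rewrite card_ffun !card_ord natrX.
(* polarization: 2 f(x) f(x + v) = f(x)^2 + f(x + v)^2 - (f(x + v) - f(x))^2 *)
have split v : lsum (fun x => f x ^+ 2)
    = lsum (fun x => f x * f (x + v)) + 2^-1 * incr_energy f v.
  have := lsumD ffF (fsupp_shift v ffF).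
  rewrite (lsum_shift (fun x => f x ^+ 2)) => h.
  have -> : lsum (fun x => f x ^+ 2) =
      2^-1 * (lsum (fun x => f x ^+ 2) + lsum (fun x => f x ^+ 2)).
    by field.
  rewrite -h -!lsumZ -lsumD; last 2 first.
  - by apply: fsuppMr.
  - by apply: fsuppMl; exact: fsupp_incr.
  by apply: eq_fsbigr => x _; field.
have -> : lsum (fun x => f x ^+ 2) = N^-1 * \sum_(v : {ffun 'I_d -> 'I_r.+1})
    lsum (fun x => f x ^+ 2).
  by rewrite sumr_const -[_ *+ #|_|]mulr_natl cardN mulKf// gt_eqF.
rewrite (eq_bigr _ (fun v _ => split (box_point e v))) big_split/=.
rewrite mulrDr lerD//.
  rewrite ler_wpM2l//.
  rewrite -(@lsum_sum _ _ _ _ (fun v x => f x * f (x + box_point e v)));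
    last first.
    by move=> v; exact: fsuppMr.
  under eq_fsbigr do rewrite -mulr_sumr.
  have -> : lsum f ^+ 2 = lsum (fun x => f x * lsum f).
    by rewrite expr2 -mulr_fsuml.
  apply: ler_lsum => [||x]; [exact: fsuppMr|exact: fsuppMr|].
  rewrite ler_wpM2l//.
  rewrite -(lsum_shift f x).
  under eq_bigr do rewrite addrC.
  apply: (@ler_lsum_inj _ _ _ (box_point e) (fun y => f (y + x))) => //.
  exact: fsupp_shift.
apply: (@le_trans _ _ (N^-1 * \sum_(v : {ffun 'I_d -> 'I_r.+1})
    ((d * r.+1)%:R ^+ 2 / 2 * G))).
  rewrite ler_wpM2l//.
  apply: ler_sum => v _; rewrite mulrAC mulrC ler_wpM2r//.
  exact: incr_energy_box.
by rewrite sumr_const -[_ *+ #|_|]mulr_natl cardN mulKf// gt_eqF.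
Qed.

End Nash.

(** * The walk as an operator on functions of the lattice *)

Section Lattice.
Context (d : nat).

Definition dir := ('I_d * bool)%type.

Definition step (s : dir) : site d :=
  if s.2 then delta_mx ord0 s.1 else - delta_mx ord0 s.1.

Definition opp_dir (s : dir) : dir := (s.1, ~~ s.2).

Lemma opp_dirK : involutive opp_dir.
Proof. by move=> [i b]; rewrite /opp_dir/= negbK. Qed.

Lemma step_opp (s : dir) : step (opp_dir s) = - step s.
Proof. by case: s => i []; rewrite /step/= ?opprK. Qed.

Lemma step_inj : injective step.
Proof.
move=> [i b] [j c] /rowP h; have := h i; have := h j.
by case: b c {h} => [] []; rewrite !mxE !eqxx/=; case: (eqVneq i j) => [->|]//=;
  rewrite eq_sym => /negPf ->.
Qed.

Lemma neighbors_step (x : site d) (s : dir) : neighbors x (x + step s).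
Proof.
case: s => i []; rewrite /step/=; first exact: (bond_neighbors (x, i)).
rewrite neighbors_sym; have := bond_neighbors (x - delta_mx ord0 i, i).
by rewrite /bond_src /bond_tgt/= subrK.
Qed.

Lemma neighborsP (x y : site d) : neighbors x y -> exists s, y = x + step s.
Proof.
move=> /neighbors_bond[[z i] [+ _]]; rewrite /bond_src/bond_tgt/= !inE.
move=> /orP[] /eqP[<- <-]; first by exists (i, true).
by exists (i, false); rewrite /step/= addrK.
Qed.

Lemma neighbor_sum (R : realType) (x : site d) (F : site d -> R) :
  (forall y, ~~ neighbors x y -> F y = 0) ->
  lsum F = \sum_(s : dir) F (x + step s).
Proof.
move=> F0; rewrite (fsbigE [seq x + step s | s <- index_enum dir]).
- by rewrite big_map; apply: eq_bigl => s; rewrite in_setT.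
- by rewrite map_inj_uniq ?index_enum_uniq// => s t /addrI /step_inj.
- by [].
- move=> y _; apply: contraNeq => Fy.
  have /neighborsP[s ->] : neighbors x y by apply: contra_neqT Fy => /F0.
  by apply: map_f; rewrite mem_index_enum.
Qed.

(** The increments 2 e_i respect the parity classes of the walk, and a box made
    of them has as many points as the box of the same side made of the e_i. *)
Lemma even_box_inj r :
  injective (@box_point _ d r (fun i => delta_mx ord0 i *+ 2 : site d)).
Proof.
move=> u v /rowP uv; apply/ffunP => j; have := uv j.
have bE (t : {ffun 'I_d -> 'I_r}) :
    box_point (fun i => delta_mx ord0 i *+ 2 : site d) t ord0 j = (2 * t j)%:Z.
  rewrite /box_point summxE (bigD1 j)//= big1 ?addr0 => [|i ij].
    rewrite -mulrnA mulmxnE !mxE !eqxx/=; exact: natz.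
  by rewrite -mulrnA mulmxnE !mxE !eqxx/= eq_sym (negPf ij) mul0rn.
rewrite !bE => -[] /eqP; rewrite eqn_mul2l/= => /eqP h; exact: val_inj.
Qed.

End Lattice.

Section Walk.
Context (R : realType) (d : nat) (w : site d -> site d -> R).
Hypothesis w_env : environment w.

Let w_ge0 x y : 0 <= w x y. Proof. by case: w_env => + _ _; apply. Qed.
Let w_sym x y : w x y = w y x. Proof. by case: w_env => _ + _; apply. Qed.
Let w_gt0 x s : 0 < w x (x + step s).
Proof. by case: w_env => _ _ h; apply/h; exact: neighbors_step. Qed.
Let w0 x y : ~~ neighbors x y -> w x y = 0.
Proof.
case: w_env => _ _ h nxy; apply/eqP; rewrite eq_le w_ge0 andbT leNgt.
by apply: contra nxy => /h.
Qed.

Local Notation pi := (total_conductance w).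

Lemma total_conductanceE x : pi x = \sum_(s : dir d) w x (x + step s).
Proof. by rewrite /total_conductance (@neighbor_sum _ _ x)//; exact: w0. Qed.

Definition walk_op (f : site d -> R) (x : site d) : R :=
  \sum_(s : dir d) transition w x (x + step s) * f (x + step s).

Lemma transition_nS n y :
  (fun x => transition_n w n.+1 x y) = walk_op (fun x => transition_n w n x y).
Proof.
apply/funext => x /=; rewrite (@neighbor_sum _ _ x)// => z xz.
by rewrite /transition w0// !mul0r.
Qed.

Lemma fsupp_walk_op f : fsupp f -> fsupp (walk_op f).
Proof.
move=> fF; apply: fsupp_sum => s; apply: fsuppMl; exact: fsupp_shift.
Qed.

(** Symmetry of the conductances: a sum over oriented edges is invariant under
    reversal of the orientation.  Invariance of pi and self-adjointness of P are
    the instances F x y = f y and F x y = f y * g x. *)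
Lemma edge_sum_swap (F : site d -> site d -> R) :
  (forall s, fsupp (fun x => F x (x + step s))) ->
  lsum (fun x => \sum_(s : dir d) w x (x + step s) * F x (x + step s)) =
  lsum (fun x => \sum_(s : dir d) w x (x + step s) * F (x + step s) x).
Proof.
move=> FF.
have FF' s : fsupp (fun x => F (x + step s) x).
  apply: sub_fsupp (fsupp_shift (step s) (FF (opp_dir s))) => x.
  by rewrite step_opp addrK.
rewrite !lsum_sum; [|by move=> s; exact: fsuppMl..].
rewrite [RHS](reindex_inj (inv_inj (@opp_dirK d)))/=; apply: eq_bigr => s _.
rewrite -[RHS](lsum_shift _ (step s)).
by apply: eq_fsbigr => x _; rewrite step_opp addrK w_sym.
Qed.

Section Positive.
Hypothesis d_gt0 : (0 < d)%N.

Lemma total_conductance_gt0 x : 0 < pi x.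
Proof.
rewrite total_conductanceE (bigD1 (Ordinal d_gt0, true))//=.
by rewrite ltr_pwDl// sumr_ge0.
Qed.

Let pi_ge0 x : 0 <= pi x. Proof. exact/ltW/total_conductance_gt0. Qed.
Let pi_neq0 x : pi x != 0.
Proof. by rewrite gt_eqF// total_conductance_gt0. Qed.

Lemma transition_ge0 x y : 0 <= transition w x y.
Proof. exact: divr_ge0. Qed.

Lemma transition_n_ge0 n x y : 0 <= transition_n w n x y.
Proof.
elim: n x => [|n IH] x; first exact: ler0n.
by apply: fsumr_ge0 => z _; rewrite mulr_ge0// transition_ge0.
Qed.

Lemma transition_n_le1 n x y : transition_n w n x y <= 1.
Proof.
elim: n x => [|n IH] x; first by rewrite /= lern1; case: (x == y).
have -> := congr1 (@^~ x) (transition_nS n y).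
rewrite /walk_op -(divff (pi_neq0 x)).
rewrite [in X in X / _]total_conductanceE mulr_suml.
by apply: ler_sum => s _; rewrite -[leRHS]mulr1 ler_wpM2l// transition_ge0.
Qed.

Lemma mul_walk_op f x :
  pi x * walk_op f x = \sum_(s : dir d) w x (x + step s) * f (x + step s).
Proof.
rewrite /walk_op mulr_sumr; apply: eq_bigr => s _.
by rewrite /transition mulrA mulrCA divff// mulr1.
Qed.

Lemma lsum_walk_op f : fsupp f ->
  lsum (fun x => pi x * walk_op f x) = lsum (fun x => pi x * f x).
Proof.
move=> fF; under eq_fsbigr do rewrite mul_walk_op.
rewrite (edge_sum_swap (F := fun _ y => f y)); last first.
  by move=> s; exact: fsupp_shift.
by apply: eq_fsbigr => x _; rewrite -mulr_suml -total_conductanceE.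
Qed.

Lemma walk_op_self_adjoint f g : fsupp f -> fsupp g ->
  lsum (fun x => pi x * (walk_op f x * g x)) =
  lsum (fun x => pi x * (f x * walk_op g x)).
Proof.
move=> fF gF.
transitivity (lsum (fun x =>
    \sum_(s : dir d) w x (x + step s) * (f (x + step s) * g x))).
  apply: eq_fsbigr => x _; rewrite mulrA mul_walk_op mulr_suml.
  by apply: eq_bigr => s _; rewrite mulrA.
rewrite (edge_sum_swap (F := fun x y => f y * g x)); last first.
  by move=> s; apply: fsuppMl.
apply: eq_fsbigr => x _; rewrite mulrCA mul_walk_op mulr_sumr.
by apply: eq_bigr => s _; rewrite mulrCA.
Qed.

End Positive.
End Walk.

(** * Decay of the heat kernel in an elliptic environment *)

(** The variance of phi under the weights a / p is half the mean squared
    difference of two independent samples; only the pairs (s, op s) are kept. *)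
Lemma variance_lower_bound (R : realType) (S : finType) (op : S -> S)
    (a phi : S -> R) : (forall s, 0 <= a s) -> 0 < \sum_s a s ->
  (\sum_s a s * phi s) ^+ 2 / (\sum_s a s) <= \sum_s a s * phi s ^+ 2
    - (2 * \sum_s a s)^-1 * \sum_s a s * a (op s) * (phi s - phi (op s)) ^+ 2.
Proof.
move=> a0; set p := \sum_s a s => p0.
have varE : \sum_s \sum_t a s * a t * (phi s - phi t) ^+ 2 =
    2 * p * (\sum_s a s * phi s ^+ 2) - 2 * (\sum_s a s * phi s) ^+ 2.
  have e s : \sum_t a s * a t * (phi s - phi t) ^+ 2 =
      a s * phi s ^+ 2 * p + a s * (\sum_t a t * phi t ^+ 2)
      - 2 * (a s * phi s) * (\sum_t a t * phi t).
    rewrite /p !mulr_sumr -big_split -sumrB/=; apply: eq_bigr => t _. ring.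
  under eq_bigr do rewrite e.
  rewrite sumrB big_split/= -!mulr_suml -mulr_sumr -/p.
  by rewrite (mulrC _ p); ring.
have opE : \sum_s a s * a (op s) * (phi s - phi (op s)) ^+ 2 <=
    \sum_s \sum_t a s * a t * (phi s - phi t) ^+ 2.
  apply: ler_sum => s _; rewrite (bigD1 (op s))//= lerDl.
  by apply: sumr_ge0 => t _; rewrite mulr_ge0 ?sqr_ge0// mulr_ge0.
rewrite -subr_ge0.
set B := \sum_s a s * phi s ^+ 2 in varE *.
set M := \sum_s a s * phi s in varE *.
set D := \sum_s a s * a (op s) * _ in opE *.
have -> : B - (2 * p)^-1 * D - M ^+ 2 / p =
   (2 * p)^-1 * ((2 * p * B - 2 * M ^+ 2) - D) by field; rewrite gt_eqF.
by rewrite mulr_ge0 ?invr_ge0 ?mulr_ge0 ?(ltW p0)// subr_ge0 -varE.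
Qed.

Lemma contraction_rate_ge0 (R : realType) d r (lam K : R) :
  (0 < d)%N -> 0 < lam <= 1 ->
  K = 2 * d%:R ^+ 4 * r.+1%:R ^+ 2 / lam ^+ 2 -> 0 <= 1 - K^-1.
Proof.
move=> d_gt0 /andP[lam_gt0 lam1] KE.
suff K1 : 1 <= K by rewrite subr_ge0 invf_le1// (lt_le_trans ltr01).
rewrite KE ler_pdivlMr ?exprn_gt0// mul1r (@le_trans _ _ 1)//.
  by rewrite exprn_ile1// ltW.
by rewrite -!natrX -!natrM ler1n !muln_gt0 d_gt0.
Qed.

Section Elliptic.
Context (R : realType) (d : nat) (w : site d -> site d -> R) (lam : R).
Hypotheses (d_gt0 : (0 < d)%N) (w_env : environment w) (lam_gt0 : 0 < lam).
Hypotheses (w_ge : forall x y, neighbors x y -> lam <= w x y)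
  (w_le : forall x y, w x y <= 1).

Local Notation pi := (total_conductance w).
Let e2 (i : 'I_d) : site d := delta_mx ord0 i *+ 2.

Let stepD2 x i : x + step (i, false) + e2 i = x + step (i, true).
Proof. by rewrite /step/= /e2 mulr2n addrA subrK. Qed.
Let w_ge0 x y : 0 <= w x y. Proof. by case: w_env => + _ _; apply. Qed.
Let w_step x s : lam <= w x (x + step s).
Proof. by apply: w_ge; exact: neighbors_step. Qed.
Let pi_gt0 x : 0 < pi x. Proof. exact: total_conductance_gt0. Qed.
Let pi_ge0 x : 0 <= pi x. Proof. exact/ltW. Qed.
Let lam_bounds : 0 < lam <= 1.
Proof.
rewrite lam_gt0; apply: le_trans (w_le 0 (0 + step (Ordinal d_gt0, true))).
exact: w_step.
Qed.

Lemma total_conductance_ge x : lam <= pi x.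
Proof.
rewrite total_conductanceE// (bigD1 (Ordinal d_gt0, true))//=.
by rewrite -[leLHS]addr0 lerD// sumr_ge0.
Qed.

Lemma total_conductance_le x : pi x <= 2 * d%:R.
Proof.
rewrite total_conductanceE// (@le_trans _ _ (\sum_(s : dir d) 1))//.
  exact: ler_sum.
by rewrite sumr_const card_prod card_ord card_bool mulnC natrM.
Qed.

Definition sq_norm (f : site d -> R) : R := lsum (fun x => pi x * f x ^+ 2).

(** The variance bound, applied at each site x to the values of f at its
    neighbors, keeps the pairs x + e_i, x - e_i; their differences are the
    increments of f along 2 e_i.  The weights lam^2 / pi(x) are at least
    lam^2 / (2d). *)
Lemma energy_drop (f : site d -> R) : fsupp f ->
  sq_norm (walk_op w f) <= sq_norm f
    - lam ^+ 2 / (2 * d%:R) * \sum_i incr_energy f (e2 i).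
Proof.
move=> fF.
have d0 : 0 < d%:R :> R by rewrite ltr0n.
pose G x : R :=
  \sum_(i < d) (f (x + step (i, true)) - f (x + step (i, false))) ^+ 2.
have GF : fsupp G.
  apply: fsupp_sum => i.
  apply: sub_fsupp (fsupp_shift (step (i, false)) (fsupp_incr (e2 i) fF)).
  by move=> x; rewrite stepD2.
have ffF : fsupp (fun x => f x ^+ 2) by exact: fsuppMr.
have -> : \sum_i incr_energy f (e2 i) = lsum G.
  rewrite /G lsum_sum; last first.
    move=> i.
    apply: sub_fsupp (fsupp_shift (step (i, false)) (fsupp_incr (e2 i) fF)).
    by move=> x; rewrite stepD2.
  apply: eq_bigr => i _; rewrite /incr_energy.
  rewrite -[LHS](lsum_shift _ (step (i, false))).
  by apply: eq_fsbigr => x _; rewrite -stepD2.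
have -> : sq_norm f = lsum (fun x =>
    \sum_(s : dir d) w x (x + step s) * f (x + step s) ^+ 2).
  rewrite (edge_sum_swap w_env (F := fun _ y => f y ^+ 2)); last first.
    by move=> s; exact: (fsupp_shift (step s) ffF).
  by apply: eq_fsbigr => x _; rewrite -mulr_suml -total_conductanceE.
have nF : fsupp (fun x =>
    \sum_(s : dir d) w x (x + step s) * f (x + step s) ^+ 2).
  by apply: fsupp_sum => s; apply: fsuppMl; exact: (fsupp_shift (step s) ffF).
rewrite -mulNr -lsumZ -lsumD//; last exact: fsuppMl.
apply: ler_lsum => [||x].
- apply: fsuppMl; apply: sub_fsupp (fsupp_walk_op w fF) => x ->.
  by rewrite expr0n.
- by apply: fsuppD => //; exact: fsuppMl.
pose a s := w x (x + step s); pose phi s := f (x + step s).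
have a0 s : 0 <= a s by exact: w_ge0.
have aE : \sum_s a s = pi x by rewrite total_conductanceE.
have p0 : 0 < \sum_s a s by rewrite aE.
have -> : pi x * walk_op w f x ^+ 2 = (\sum_s a s * phi s) ^+ 2 / (\sum_s a s).
  by rewrite -mul_walk_op// aE; field; rewrite gt_eqF.
apply: le_trans (variance_lower_bound (@opp_dir d) phi a0 p0) _.
rewrite lerD2l mulNr lerN2 aE.
apply: (@le_trans _ _ ((2 * (2 * d%:R))^-1 * (lam ^+ 2 * (2 * G x)))).
  by rewrite le_eqVlt; apply/orP; left; apply/eqP; field; rewrite gt_eqF.
apply: ler_pM.
- by rewrite invr_ge0 !mulr_ge0// ltW.
- rewrite mulr_ge0 ?sqr_ge0// mulr_ge0//.
  by apply: sumr_ge0 => i _; exact: sqr_ge0.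
- by rewrite lef_pV2 ?posrE ?mulr_gt0// ler_pM2l// total_conductance_le.
have -> : 2 * G x = \sum_s (phi s - phi (opp_dir s)) ^+ 2.
  rewrite -(pair_bigA _ (fun i b => (phi (i, b) - phi (opp_dir (i, b))) ^+ 2))/=.
  rewrite /G mulr_sumr; apply: eq_bigr => i _.
  by rewrite big_bool/= /phi /opp_dir/=; ring.
rewrite mulr_sumr; apply: ler_sum => s _; rewrite ler_wpM2r ?sqr_ge0// expr2.
by rewrite ler_pM// ?(ltW lam_gt0)//; exact: w_step.
Qed.

(** The Nash-type inequality bounds the energy below by the squared norm, up to
    the additive A; inserted in the energy drop it gives a contraction to A. *)
Lemma sq_norm_contraction (f : site d -> R) r (A K : R) :
  fsupp f -> (forall x, 0 <= f x) ->
  lsum (fun x => pi x * f x) = 1 ->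
  A = 2 * d%:R / (r.+1%:R ^+ d * lam ^+ 2) ->
  K = 2 * d%:R ^+ 4 * r.+1%:R ^+ 2 / lam ^+ 2 ->
  sq_norm (walk_op w f) - A <= (1 - K^-1) * (sq_norm f - A).
Proof.
move=> fF f0 f1 AE KE.
have d0 : 0 < d%:R :> R by rewrite ltr0n.
have r0 : 0 < r.+1%:R :> R by [].
have K0 : 0 < K by rewrite KE divr_gt0 ?mulr_gt0 ?exprn_gt0.
have ffF : fsupp (fun x => f x ^+ 2) by exact: fsuppMr.
have l1 : lsum f <= lam^-1.
  rewrite -[leRHS]mul1r ler_pdivlMr// mulrC -f1 -lsumZ.
  apply: ler_lsum => [||x]; [exact: fsuppMl|exact: fsuppMl|].
  by rewrite ler_wpM2r// total_conductance_ge.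
have l10 : 0 <= lsum f by apply: fsumr_ge0 => x _.
have n2 : sq_norm f <= 2 * d%:R * lsum (fun x => f x ^+ 2).
  rewrite -lsumZ; apply: ler_lsum => [||x]; [exact: fsuppMl|exact: fsuppMl|].
  by rewrite ler_wpM2r ?sqr_ge0// total_conductance_le.
have := box_nash fF f0 (@even_box_inj d r.+1).
have := energy_drop fF; rewrite -/e2.
set G := \sum_i _ => drop nash.
have {}nash : sq_norm f <= A + K * (lam ^+ 2 / (2 * d%:R) * G).
  apply: le_trans n2 _.
  apply: (@le_trans _ _ (2 * d%:R * ((r.+1%:R ^+ d)^-1 * lam^-1 ^+ 2
    + (d * r.+1)%:R ^+ 2 / 2 * G))).
    rewrite ler_pM2l ?mulr_gt0//; apply: le_trans nash _; rewrite lerD2r.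
    by rewrite ler_wpM2l ?invr_ge0 ?exprn_ge0// ler_pXn2r// nnegrE invr_ge0 ltW.
  rewrite le_eqVlt; apply/orP; left; apply/eqP.
  rewrite AE KE natrM.
  set q := r.+1%:R ^+ d.
  have q0 : q != 0 by rewrite gt_eqF// exprn_gt0.
  by field; rewrite q0 !gt_eqF.
have : K^-1 * sq_norm f <= K^-1 * A + lam ^+ 2 / (2 * d%:R) * G.
  by rewrite -[X in _ + X](mulKf (lt0r_neq0 K0)) -mulrDr ler_pM2l ?invr_gt0.
move: drop; set E := _ / _ * G; set u := sq_norm _; set v := sq_norm _ => h1 h2.
by rewrite mulrBl !mul1r mulrBr; lra.
Qed.

(** With the target y fixed and the starting point as variable, the recursion
    that defines the n-step kernel is an iteration of the walk operator. *)
Definition heat_density (y : site d) (n : nat) (x : site d) : R :=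
  transition_n w n x y / pi y.

Lemma heat_densityS y n : heat_density y n.+1 = walk_op w (heat_density y n).
Proof.
apply/funext => x; rewrite /heat_density.
have -> := congr1 (@^~ x) (transition_nS w_env n y).
by rewrite /walk_op mulr_suml; apply: eq_bigr => s _; rewrite mulrA.
Qed.

Lemma fsupp_heat_density y n : fsupp (heat_density y n).
Proof.
elim: n => [|n IH]; last by rewrite heat_densityS; exact: fsupp_walk_op.
apply/fsuppP; exists [fset y]%fset => x; rewrite in_fset1 /heat_density/=.
by move=> /negPf ->; rewrite mul0r.
Qed.

Lemma heat_density_ge0 y n x : 0 <= heat_density y n x.
Proof. by rewrite divr_ge0// transition_n_ge0. Qed.

Lemma lsum_heat_density0 y (F : site d -> R) :
  lsum (fun x => pi x * (F x * heat_density y 0 x)) = F y.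
Proof.
rewrite (fsbigTE [fset y]%fset); last first.
  move=> x; rewrite in_fset1 /heat_density/= => /negPf ->.
  by rewrite mul0r !mulr0.
rewrite big_seq_fset1 /heat_density/= eqxx mul1r mulrCA divff ?mulr1//.
by rewrite gt_eqF.
Qed.

Lemma heat_density_mass y n : lsum (fun x => pi x * heat_density y n x) = 1.
Proof.
elim: n => [|n IH].
  under eq_fsbigr do rewrite -[heat_density _ _ _]mul1r.
  by rewrite (lsum_heat_density0 y (fun=> 1)).
by rewrite heat_densityS lsum_walk_op//; exact: fsupp_heat_density.
Qed.

Lemma sq_norm_decay y n r (A K : R) :
  A = 2 * d%:R / (r.+1%:R ^+ d * lam ^+ 2) ->
  K = 2 * d%:R ^+ 4 * r.+1%:R ^+ 2 / lam ^+ 2 ->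
  sq_norm (heat_density y n) <= A + (1 - K^-1) ^+ n / lam.
Proof.
move=> AE KE.
have K1 := contraction_rate_ge0 d_gt0 lam_bounds KE.
have A0 : 0 <= A by rewrite AE divr_ge0 ?mulr_ge0 ?exprn_ge0 ?(ltW lam_gt0).
suff : sq_norm (heat_density y n) - A <= (1 - K^-1) ^+ n / lam.
  by rewrite lerBlDl.
elim: n => [|n IH].
  rewrite expr0 lerBlDr -[leLHS]addr0 lerD//.
  have -> : sq_norm (heat_density y 0) = (pi y)^-1.
    rewrite /sq_norm; under eq_fsbigr do rewrite expr2.
    rewrite (lsum_heat_density0 y (heat_density y 0)).
    by rewrite /heat_density/= eqxx mul1r.
  by rewrite mul1r lef_pV2 ?posrE// total_conductance_ge.
rewrite heat_densityS.
apply: (le_trans (sq_norm_contraction (fsupp_heat_density y n)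
  (heat_density_ge0 y n) (heat_density_mass y n) AE KE)).
by rewrite exprS -mulrA ler_wpM2l.
Qed.

(** Chapman-Kolmogorov in symmetric form: the steps are moved from one factor
    to the other by self-adjointness, starting from a unit mass at x. *)
Lemma heat_density_pairing x y m n :
  heat_density y (m + n) x =
  lsum (fun z => pi z * (heat_density y n z * heat_density x m z)).
Proof.
elim: m n => [|m IH] n; first by rewrite lsum_heat_density0.
rewrite addSnnS IH !heat_densityS walk_op_self_adjoint//;
  exact: fsupp_heat_density.
Qed.

(** Splitting the n steps in two halves, the inequality 2ab <= a^2 + b^2 bounds
    P^n(x, y) by the mean of two squared norms; the half n./2 is the shorter
    one, which makes the bound valid for odd n as well. *)
Lemma elliptic_heat_kernel_bound x y n r (A K : R) :
  A = 2 * d%:R / (r.+1%:R ^+ d * lam ^+ 2) ->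
  K = 2 * d%:R ^+ 4 * r.+1%:R ^+ 2 / lam ^+ 2 ->
  transition_n w n x y <= 2 * d%:R * (A + (1 - K^-1) ^+ n./2 / lam).
Proof.
move=> AE KE.
have K1 := contraction_rate_ge0 d_gt0 lam_bounds KE.
have K0 : 0 < K.
  by rewrite KE divr_gt0 ?mulr_gt0 ?exprn_gt0 ?ltr0n.
set E := A + _.
have -> : transition_n w n x y = pi y * heat_density y n x.
  by rewrite /heat_density mulrCA divff ?mulr1// gt_eqF.
have -> : n = (n./2 + uphalf n)%N.
  by rewrite uphalf_half addnCA addnn odd_double_half.
rewrite ler_pM//; first exact: heat_density_ge0.
  exact: total_conductance_le.
rewrite heat_density_pairing.
have fF y' n' := fsupp_heat_density y' n'.
apply: (@le_trans _ _ (2^-1 * (sq_norm (heat_density y (uphalf n))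
    + sq_norm (heat_density x n./2)))).
  rewrite -lsumD; [|by apply: fsuppMl; apply: fsuppMr..].
  rewrite -lsumZ; apply: ler_lsum => [||z].
  - by apply: fsuppMl; apply: fsuppMr.
  - by apply: fsuppMl; apply: fsuppD; apply: fsuppMl; apply: fsuppMr.
  - rewrite -mulrDr [leRHS]mulrCA ler_wpM2l//.
    rewrite -subr_ge0; set a := heat_density _ _ _; set b := heat_density _ _ _.
    have -> : 2^-1 * (a ^+ 2 + b ^+ 2) - a * b = 2^-1 * (a - b) ^+ 2 by field.
    by rewrite mulr_ge0 ?sqr_ge0.
have E1 : sq_norm (heat_density x n./2) <= E.
  exact: (sq_norm_decay x n./2 AE KE).
have E2 : sq_norm (heat_density y (uphalf n)) <= E.
  apply: le_trans (sq_norm_decay y (uphalf n) AE KE) _.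
  rewrite lerD2l ler_wpM2r ?invr_ge0 ?(ltW lam_gt0)//.
  apply: ler_wiXn2l => //; last by rewrite uphalf_half leq_addl.
  by rewrite lerBlDl lerDr invr_ge0 ltW.
lra.
Qed.

End Elliptic.

(** * Replacing the environment far away from the origin *)

Section Locality.
Context (R : realType) (d : nat).

Definition in_box (k : nat) (x : site d) : bool :=
  [forall i, `|x ord0 i| <= k%:Z].

Lemma in_box_step k x (s : dir d) : in_box k x -> in_box k.+1 (x + step s).
Proof.
move=> /forallP h; apply/forallP => i; rewrite mxE -[k.+1]addn1 PoszD.
apply: le_trans (ler_normD _ _) _; rewrite lerD//.
case: s => j b; rewrite /step/=; case: b; rewrite !mxE ?normrN;
  by case: (_ && _).
Qed.

Lemma transition_n_local (w w' : site d -> site d -> R) k n x y :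
  environment w -> environment w' -> in_box k x ->
  (forall z, in_box (k + n) z -> w z = w' z) ->
  transition_n w n x y = transition_n w' n x y.
Proof.
move=> we we'; elim: n k x => [//|n IH] k x kx ww'.
have xx : w x = w' x.
  apply: ww'; apply/forallP => i; move/forallP: kx => /(_ i) h.
  by rewrite (le_trans h)// lez_nat leq_addr.
rewrite (congr1 (@^~ x) (transition_nS we n y)).
rewrite (congr1 (@^~ x) (transition_nS we' n y)).
rewrite /walk_op; apply: eq_bigr => s _; congr (_ * _).
  by rewrite /transition /total_conductance xx.
by apply: (IH k.+1) => [|z]; [exact: in_box_step|rewrite addSnnS; exact: ww'].
Qed.

(** Raising all the small conductances, wherever they are, gives an elliptic
    environment that agrees with the given one on the box where the latter has
    no small conductance. *)
Definition truncate_env (lam : R) (w : site d -> site d -> R) (x y : site d)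
    : R :=
  if neighbors x y then Num.max lam (w x y) else 0.

Lemma truncate_env_environment lam w : 0 < lam -> environment w ->
  environment (truncate_env lam w).
Proof.
move=> l0 [_ w_sym _]; rewrite /truncate_env; split => x y.
- by case: ifP => // _; rewrite le_max ltW.
- by rewrite neighbors_sym w_sym.
- by case: ifP => // _; rewrite ?ltxx// lt_max l0.
Qed.

Lemma box_heat_kernel_bound (w : site d -> site d -> R) lam n r y (A K : R) :
  (0 < d)%N -> environment w -> (forall x y, w x y <= 1) -> 0 < lam <= 1 ->
  (forall x z, in_box n x -> neighbors x z -> lam <= w x z) ->
  A = 2 * d%:R / (r.+1%:R ^+ d * lam ^+ 2) ->
  K = 2 * d%:R ^+ 4 * r.+1%:R ^+ 2 / lam ^+ 2 ->
  transition_n w n 0 y <= 2 * d%:R * (A + (1 - K^-1) ^+ n./2 / lam).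
Proof.
move=> d0 we w1 /andP[l0 l1] wl AE KE.
have te := truncate_env_environment l0 we.
have -> : transition_n w n 0 y = transition_n (truncate_env lam w) n 0 y.
  apply: (transition_n_local (k := 0)) => //.
    by apply/forallP => i; rewrite mxE normr0.
  move=> z nz; apply/funext => z'; rewrite /truncate_env.
  case: ifPn => zz'; first by apply/esym/max_idPr; exact: wl.
  apply/eqP; case: (we) => w0 _ h; rewrite eq_le w0 andbT leNgt.
  by apply: contra zz' => /h.
apply: (elliptic_heat_kernel_bound d0 te l0 _ _ 0 y n AE KE).
- by move=> x z xz; rewrite /truncate_env xz le_max lexx.
- by move=> x z; rewrite /truncate_env; case: ifP => // _; rewrite ge_max l1 w1.
Qed.

End Locality.

(** * The choice of the scale *)

Section Asymptotics.
Context (R : realType).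
Implicit Types eps x : R.

Lemma near_powR_ge (M eps : R) : 0 < eps ->
  \forall n \near \oo, M <= n%:R `^ eps.
Proof.
move=> e0; near=> n.
apply: (le_trans (ler_norm M)).
have -> : `|M| = (`|M| `^ eps^-1) `^ eps.
  by rewrite -powRrM mulVf ?lt0r_neq0// powRr1.
apply: ge0_ler_powR; rewrite ?nnegrE ?powR_ge0 ?(ltW e0)//.
near: n; exact: nbhs_infty_ger.
Unshelve. all: end_near. Qed.

Lemma expR_beats_power (C c : R) k : 0 < c -> exists M : R,
  forall x, M <= x -> C * x ^+ k <= expR (c * x ^+ 2).
Proof.
move=> c0; pose a : R := c ^+ k.+1 / k.+1`!%:R.
have a0 : 0 < a by rewrite divr_gt0 ?exprn_gt0// ltr0n fact_gt0.
exists (Num.max 1 (C / a)) => x; rewrite ge_max => /andP[x1 xC].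
have x0 : 0 <= x by exact: le_trans xC || exact: le_trans x1.
have y0 : 0 <= c * x ^+ 2 by rewrite mulr_ge0 ?sqr_ge0// ltW.
apply: le_trans (expR_ge1Dxn k y0); rewrite -[leLHS]add0r lerD//.
have -> : (c * x ^+ 2) ^+ k.+1 / k.+1`!%:R = a * (x ^+ k.+1 * x ^+ k.+1).
  by rewrite exprMn -exprM mul2n -addnn exprD mulrAC.
apply: (@le_trans _ _ (a * x * x ^+ k)).
  by rewrite ler_wpM2r ?exprn_ge0// mulrC -ler_pdivrMr.
rewrite -mulrA -exprS ler_pM2l// -[leLHS]mulr1 ler_wpM2l ?exprn_ge0//.
exact: exprn_ege1.
Qed.

(** With X = n^eps, D = n^(-d/2) and r of order H = n^(1/2 - 2 eps), the first
    term is at most 4 d^2 D X^(2d + 2), and n / K is at least of order X^2, so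
    that the second term decays faster than any power of X.  The additional
    factor X in the right-hand side absorbs the constants. *)
Lemma scale_bound d n r k (eps lam A K : R) :
  (0 < d)%N -> (2 <= n)%N -> 0 < eps -> 4 * eps <= 1 ->
  lam = n%:R `^ (- eps) -> r = Num.truncn (n%:R `^ (2^-1 - 2 * eps)) ->
  A = 2 * d%:R / (r.+1%:R ^+ d * lam ^+ 2) ->
  K = 2 * d%:R ^+ 4 * r.+1%:R ^+ 2 / lam ^+ 2 ->
  d%:R / 2 <= k%:R * eps ->
  8 * d%:R ^+ 2 <= n%:R `^ eps ->
  4 * d%:R * (n%:R `^ eps) ^+ k
    <= expR ((24 * d%:R ^+ 4)^-1 * (n%:R `^ eps) ^+ 2) ->
  2 * d%:R * (A + (1 - K^-1) ^+ n./2 / lam)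
    <= n%:R `^ (- (d%:R / 2) + (2 * d + 3)%:R * eps).
Proof.
move=> d0 n2 e0 e4 lamE rE AE KE ke.
have nN : n%:R != 0 :> R by rewrite pnatr_eq0 -lt0n (leq_trans _ n2).
have n0 : 0 < n%:R :> R by rewrite lt_neqAle eq_sym nN /=.
have n1 : 1 <= n%:R :> R by rewrite ler1n (leq_trans _ n2).
have D0 : 1 <= d%:R :> R by rewrite ler1n.
have Dpos : 0 < d%:R :> R by rewrite ltr0n.
set X := n%:R `^ eps => X8 Xexp.
have X0 : 0 < X by exact: powR_gt0.
have X1 : 1 <= X by rewrite -(powRr0 n%:R) ler_powR// ltW.
have XN := lt0r_neq0 X0.
have XE j : X ^+ j = n%:R `^ (eps * j%:R) by rewrite powRrM powR_mulrn// ltW.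
have lamX : lam = X^-1 by rewrite lamE powRN.
have K1 : 0 <= 1 - K^-1.
  apply: (contraction_rate_ge0 d0 _ KE).
  by rewrite lamX invr_gt0 X0 invf_le1.
pose D : R := n%:R `^ (- (d%:R / 2)).
have Dp : 0 < D by exact: powR_gt0.
have -> : n%:R `^ (- (d%:R / 2) + (2 * d + 3)%:R * eps) = D * X ^+ (2 * d + 3).
  by rewrite powRD ?nN ?implybT// XE [eps * _]mulrC.
set rr : R := r.+1%:R in AE KE.
have rr0 : 0 < rr by rewrite /rr.
pose H : R := n%:R `^ (2^-1 - 2 * eps).
have H1 : 1 <= H by rewrite -(powRr0 n%:R) ler_powR//; lra.
have H0 : 0 < H by exact: lt_le_trans ltr01 H1.
have /andP[rH Hr] := truncn_itv (ltW H0).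
have {}Hr : H <= rr by rewrite /rr rE ltW.
have {}rH : rr <= 2 * H.
  have -> : 2 * H = H + H by ring.
  by rewrite /rr rE -natr1 lerD.
have HdE : H ^+ d * (D * X ^+ (2 * d)) = 1.
  rewrite -powR_mulrn ?(ltW H0)// -powRrM XE -!powRD ?nN ?implybT//.
  rewrite natrM; have -> : (2^-1 - 2 * eps) * d%:R
    + (- (d%:R / 2) + eps * (2 * d%:R)) = 0 by field.
  exact: powRr0.
have H2E : H ^+ 2 * X ^+ 4 = n%:R.
  rewrite -powR_mulrn ?(ltW H0)// -powRrM XE -!powRD ?nN ?implybT//.
  have -> : (2^-1 - 2 * eps) * 2 + eps * 4 = 1 by field.
  by rewrite powRr1// ltW.
have term1 : A <= 2 * d%:R * D * X ^+ (2 * d + 2).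
  rewrite AE lamX exprVn ler_pdivrMr ?mulr_gt0 ?exprn_gt0
    ?invr_gt0 ?exprn_gt0//.
  have -> : 2 * d%:R * D * X ^+ (2 * d + 2) * (rr ^+ d * (X ^+ 2)^-1) =
     2 * d%:R * (rr ^+ d * (D * X ^+ (2 * d))).
    by rewrite exprD; field; rewrite XN.
  rewrite ler_pMr ?mulr_gt0// -[leLHS]HdE.
  rewrite ler_pM2r ?mulr_gt0 ?exprn_gt0//.
  by rewrite ler_pXn2r ?nnegrE ?(ltW H0) ?(ltW rr0).
have KEX : K = 2 * d%:R ^+ 4 * rr ^+ 2 * X ^+ 2.
  by rewrite KE lamX exprVn invrK.
have K0 : 0 < K by rewrite KEX !mulr_gt0 ?exprn_gt0.
have rate : (24 * d%:R ^+ 4)^-1 * X ^+ 2 <= (n./2)%:R / K.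
  rewrite ler_pdivlMr// -mulrA ler_pdivrMl ?mulr_gt0 ?exprn_gt0//.
  have m3 : n%:R <= 3 * (n./2)%:R :> R.
    rewrite -natrM ler_nat -[leqLHS]odd_double_half mulSn mul2n leq_add2r.
    by rewrite (leq_trans (leq_b1 _))// half_gt0.
  have r2 : rr ^+ 2 <= 4 * H ^+ 2.
    have -> : 4 * H ^+ 2 = (2 * H) ^+ 2 by ring.
    by rewrite ler_pXn2r ?nnegrE ?mulr_ge0// ltW.
  apply: (@le_trans _ _ (8 * d%:R ^+ 4 * n%:R)); last first.
    rewrite [leRHS](_ : _ = 8 * d%:R ^+ 4 * (3 * (n./2)%:R)); last by ring.
    by rewrite ler_pM2l ?mulr_gt0 ?exprn_gt0.
  rewrite KEX -H2E.
  have -> : X ^+ 2 * (2 * d%:R ^+ 4 * rr ^+ 2 * X ^+ 2) =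
    2 * d%:R ^+ 4 * X ^+ 4 * rr ^+ 2 by ring.
  have -> : 8 * d%:R ^+ 4 * (H ^+ 2 * X ^+ 4) =
    2 * d%:R ^+ 4 * X ^+ 4 * (4 * H ^+ 2) by ring.
  by rewrite ler_pM2l// !mulr_gt0 ?exprn_gt0.
have decay : (1 - K^-1) ^+ n./2 <= (4 * d%:R * X ^+ k)^-1.
  have h : 1 - K^-1 <= expR (- K^-1) by exact: expR_ge1Dx.
  apply: (@le_trans _ _ (expR (- K^-1) ^+ n./2)).
    by rewrite lerXn2r ?nnegrE ?expR_ge0.
  rewrite -expRM_natl mulrN expRN lef_pV2 ?posrE ?expR_gt0
    ?mulr_gt0 ?exprn_gt0//.
  by apply: le_trans Xexp _; rewrite ler_expR.
have XkD : 1 <= D * X ^+ k.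
  rewrite XE -powRD ?nN ?implybT// -[leLHS](powRr0 n%:R) ler_powR//; lra.
have term2 : (1 - K^-1) ^+ n./2 / lam <= (4 * d%:R)^-1 * D * X.
  rewrite lamX invrK ler_wpM2r ?(ltW X0)//; apply: le_trans decay _.
  rewrite invfM ler_pM2l ?invr_gt0 ?mulr_gt0//.
  by rewrite -[leLHS]mul1r ler_pdivrMr ?exprn_gt0.
apply: (@le_trans _ _ (2 * d%:R *
    (2 * d%:R * D * X ^+ (2 * d + 2) + (4 * d%:R)^-1 * D * X))).
  by rewrite ler_pM2l ?mulr_gt0// lerD.
rewrite mulrDr.
have -> : 2 * d%:R * ((4 * d%:R)^-1 * D * X) = 2^-1 * (D * X).
  by field; rewrite lt0r_neq0.
have -> : 2 * d%:R * (2 * d%:R * D * X ^+ (2 * d + 2)) =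
  2^-1 * (D * X ^+ (2 * d + 2)) * (8 * d%:R ^+ 2) by field.
have -> : D * X ^+ (2 * d + 3) =
    2^-1 * (D * X ^+ (2 * d + 2)) * X + 2^-1 * (D * X ^+ (2 * d + 3)).
  by rewrite (addnS _ 2) exprSr; field.
apply: lerD.
  by rewrite ler_pM2l ?mulr_gt0 ?exprn_gt0.
rewrite ler_pM2l// ler_pM2l// addnS exprS -[leLHS]mulr1 ler_pM2l//.
exact: exprn_ege1.
Qed.

End Asymptotics.

(** * Limit superior and Borel-Cantelli *)

Lemma limn_esup_log_le (R : realType) (X : Type) (p : nat -> X -> R) (b : R) :
  (\forall n \near \oo, forall x, p n x <= n%:R `^ b) ->
  (limn_esup (fun n : nat => ereal_sup (range (fun x : X =>
     lne (p n x)%:E / (ln n%:R)%:E))) <= b%:E)%E.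
Proof.
move=> pb.
have : \forall n \near \oo, (1 < n)%N /\ forall x, p n x <= n%:R `^ b.
  by near=> n; split; [near: n; exact: nbhs_infty_gt|near: n].
move=> [N _ NP]; rewrite /limn_esup /limf_esup.
apply: (@le_trans _ _ (ereal_sup [set ereal_sup (range (fun x : X =>
     lne (p n x)%:E / (ln n%:R)%:E))%E | n in [set n | (N <= n)%N]])).
  by apply: ereal_inf_lbound; exists [set n | (N <= n)%N] => //; exists N.
apply: ge_ereal_sup => _ [n /= Nn <-]; apply: ge_ereal_sup => _ [x _ <-].
have [n1 /(_ x) pnb] := NP n Nn.
have l0 : 0 < ln n%:R :> R by rewrite ln_gt0// ltr1n.
rewrite inver gt_eqF//; have [p0|p0] := leP (p n x) 0.
  by rewrite lee_pdivrMr// leNye.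
rewrite lee_pdivrMr// -EFinM lee_fin -ln_powR.
by rewrite ler_ln ?posrE ?powR_gt0 ?ltr0n// ltnW.
Unshelve. all: end_near. Qed.

Lemma cvg_div_pinfty (R : realType) (c : R) : c / x @[x --> +oo] --> (0 : R).
Proof.
apply/cvgrPdist_lt => e e0; near=> x.
have x0 : 0 < x by near: x; exact/nbhs_pinfty_gt/num_real.
rewrite sub0r normrN normrM normfV (gtr0_norm x0) ltr_pdivrMr// mulrC.
by rewrite -ltr_pdivrMr//; near: x; exact/nbhs_pinfty_gt/num_real.
Unshelve. all: end_near. Qed.

Section BorelCantelli.
Context (disp : measure_display) (T : measurableType disp) (R : realType)
  (Q : {measure set T -> \bar R}).

Lemma sum_telescope n :
  \sum_(0 <= i < n) (i.+1%:R * i.+2%:R : R)^-1 = 1 - n.+1%:R^-1.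
Proof.
elim: n => [|n IH]; first by rewrite big_nil invr1 subrr.
rewrite big_nat_recr//= IH -[n.+2%:R]natr1.
have n0 : 0 < n.+1%:R :> R by [].
have n1 : 0 < n.+1%:R + 1 :> R by rewrite addr_gt0.
by field; rewrite !lt0r_neq0.
Qed.

(** The rate 1 / ((k + 1)(k + 2)) telescopes, which makes its sum explicit. *)
Lemma borel_cantelli_eventually (F : nat -> set T) (C : R) :
  (forall k, measurable (F k)) ->
  (forall k, Q (F k) <= (C * (k.+1%:R * k.+2%:R)^-1)%:E)%E ->
  {ae Q, forall t, \forall k \near \oo, ~ F k t}.
Proof.
move=> mF FC; exists (lim_sup_set F); split.
- by apply: bigcap_measurable => // k _; apply: bigcup_measurable.
- apply: lim_sup_set_cvg0 => //.
  apply: (@le_lt_trans _ _ C%:E); last exact: ltry.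
  have C0 : 0 <= C.
    have := le_trans (measure_ge0 Q _) (FC 0%N).
    by rewrite lee_fin pmulr_lge0// invr_gt0.
  apply: lime_le; first by apply: is_cvg_nneseries => *; exact: measure_ge0.
  apply: nearW => n.
  apply: (@le_trans _ _ (\sum_(0 <= k < n) (C * (k.+1%:R * k.+2%:R)^-1)%:E)%E).
    by apply: lee_sum => k _; exact: FC.
  rewrite sumEFin lee_fin -mulr_sumr sum_telescope.
  by rewrite -[leRHS]mulr1 ler_wpM2l// gerBl.
- move=> t /= nt k _; apply: contrapT => h; apply: nt.
  exists k => // j /= kj Fj; apply: h; exists j => //.
Qed.

End BorelCantelli.

(** * Almost sure lower bound on the conductances near the origin *)

Section BoxUnionBound.
Context (d : nat).

Definition box_site m (v : {ffun 'I_d -> 'I_(2 * m).+1}) : site d :=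
  \row_i ((v i)%:Z - m%:Z).

Lemma box_siteP m (x : site d) : in_box m x -> exists v, x = @box_site m v.
Proof.
move=> /forallP h.
have hb i : (`|(x ord0 i + m%:Z)%R| < (2 * m).+1)%N.
  by move: (h i); move: (x ord0 i) => y; lia.
exists [ffun i => Ordinal (hb i)]; apply/rowP => i; rewrite !mxE ffunE/=.
rewrite (ord1 (0 : 'I_1)) in h *.
by move: (h i); move: (x _ i) => y; lia.
Qed.

Lemma measure_bigsetU_le (disp : measure_display) (T : measurableType disp)
    (R : realType) (Q : {measure set T -> \bar R}) (I : finType)
    (F : I -> set T) (c : R) :
  (forall i, measurable (F i)) -> (forall i, Q (F i) <= c%:E)%E ->
  (Q (\big[setU/set0]_i F i) <= (#|I|%:R * c)%:E)%E.
Proof.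
move=> mF Fc.
suff : measurable (\big[setU/set0]_i F i) /\
    (Q (\big[setU/set0]_i F i) <= (\sum_(i : I) c)%:E)%E.
  by move=> [_]; rewrite sumr_const mulr_natl.
elim/big_rec2 : _ => [|i y A _ [mA Ay]].
  by split; [exact: measurable0|rewrite measure0].
split; first exact: measurableU.
rewrite EFinD; apply: le_trans (measureU2 _ (mF i) mA) _.
exact: (leeD (Fc i) Ay).
Qed.

End BoxUnionBound.

Lemma box_side_le n : ((2 * n.+2).+1 <= 7 * n.+1)%N. Proof. lia. Qed.

Lemma shifted_square_ge k N : (k.+1 * k.+2 <= 2 * (k + N).+1 ^ 2)%N.
Proof. nia. Qed.

Lemma in_box_mono d m n (x : site d) : (m <= n)%N -> in_box m x -> in_box n x.
Proof.
by move=> mn /forallP h; apply/forallP => i; rewrite (le_trans (h i)) ?lez_nat.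
Qed.

Section LowConductances.
Context (R : realType) (d : nat) (gamma : R) (disp : measure_display)
  (T : measurableType disp) (Q : probability T R)
  (omega : site d -> site d -> {RV Q >-> R}).
Hypotheses (d_gt0 : (0 < d)%N) (gamma_gt0 : 0 < gamma).
Hypothesis omega_env : forall t, environment (fun x y => omega x y t).
Hypothesis omega_id :
  identically_distributed (fun b : bond d => omega (bond_src b) (bond_tgt b)).
Hypothesis omega_tail : forall b : bond d,
  fine (Q [set t | omega (bond_src b) (bond_tgt b) t <= a])
    / a `^ gamma @[a --> 0^'+] --> (1 : R).

Let low (b : bond d) (a : R) : set T :=
  [set t | omega (bond_src b) (bond_tgt b) t <= a].

Lemma low_preimage b a :
  low b a = omega (bond_src b) (bond_tgt b) @^-1` `]-oo, a].
Proof. by apply/seteqP; split=> t /=; rewrite in_itv. Qed.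

Lemma measurable_low b a : measurable (low b a).
Proof.
by rewrite low_preimage -[_ @^-1` _]setTI; exact: measurable_funPT.
Qed.

(** The bonds are identically distributed, so the threshold below which the tail
    asymptotics at one bond take effect is the same for all bonds. *)
Lemma low_probability : exists2 e : R, 0 < e &
  forall b a, 0 < a < e -> (Q (low b a) <= (2 * a `^ gamma)%:E)%E.
Proof.
pose b0 : bond d := (0, Ordinal d_gt0).
have /cvgrPdist_lt/(_ 1 ltr01) := omega_tail b0.
move=> [e /= e0 eP]; exists e => // b a /andP[a0 ae].
have -> : Q (low b a) = Q (low b0 a).
  rewrite !low_preimage; exact: (omega_id b b0 (measurable_itv `]-oo, a])).
have ag : 0 < a `^ gamma by exact: powR_gt0.
rewrite -[Q _]fineK; last exact: fin_num_measure _ _ (measurable_low _ _).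
have := eP a; rewrite /ball_/= sub0r normrN gtr0_norm// => /(_ ae a0).
rewrite -/(low b0 a) ltr_distlC => /andP[_ +].
rewrite ltr_pdivrMr// lee_fin => /ltW h.
by apply: le_trans h _; rewrite ler_wpM2r//; lra.
Qed.

(** About n^d bonds, each of them low with probability at most
    2 n^-(eps gamma) = 2 n^-(d + 2): by the union bound the failure probability
    is O(n^-2), which is summable. *)
Lemma eventually_no_low_conductance :
  {ae Q, forall t, \forall n \near \oo, forall x y, in_box n x ->
    neighbors x y -> n%:R `^ (- ((d + 2)%:R / gamma)) <= omega x y t}.
Proof.
set eps : R := (d + 2)%:R / gamma.
have eps0 : 0 < eps by rewrite divr_gt0// ltr0n addnS.
have [e e0 eP] := low_probability.
have [N _ NP] : \forall n \near \oo, e^-1 + 1 <= n%:R `^ eps.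
  exact: near_powR_ge.
pose level n : R := n%:R `^ (- eps).
(* The box has radius n + 1 for n = k + N + 1, since a bond is indexed by its
   lower end, which may lie just outside the box of radius n. *)
pose F k : set T :=
  \big[setU/set0]_(p : {ffun 'I_d -> 'I_(2 * (k + N).+2).+1} * 'I_d)
  low (box_site p.1, p.2) (level (k + N).+1).
have mF k : measurable (F k).
  by apply: bigsetU_measurable => p _; exact: measurable_low.
have FC k : (Q (F k) <= (4 * d%:R * 7 ^+ d * (k.+1%:R * k.+2%:R)^-1)%:E)%E.
  set n := (k + N).+1.
  have n0 : 0 < n%:R :> R by [].
  have l0 : 0 < level n by exact: powR_gt0.
  have le : level n < e.
    rewrite /level powRN -[e]invrK ltf_pV2 ?posrE ?powR_gt0 ?invr_gt0//.
    apply: lt_le_trans (NP n _); first by rewrite ltrDl.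
    by rewrite /n/= -addSn leq_addl.
  have lg : level n `^ gamma = (n%:R ^+ (d + 2))^-1.
    rewrite /level -powRrM mulNr divfK ?gt_eqF// powRN powR_mulrn//.
  apply: (le_trans (measure_bigsetU_le (c := 2 * level n `^ gamma) _ _)).
  - by move=> p; exact: measurable_low.
  - by move=> p; apply: eP; rewrite l0.
  rewrite lee_fin card_prod card_ffun !card_ord lg.
  have c7 : ((2 * n.+1).+1 ^ d)%:R <= 7 ^+ d * n%:R ^+ d :> R.
    by rewrite -exprMn -natrM -natrX ler_nat leq_exp2r// box_side_le.
  rewrite natrM exprD.
  apply: (@le_trans _ _ (7 ^+ d * n%:R ^+ d * d%:R *
      (2 * (n%:R ^+ d * n%:R ^+ 2)^-1))).
    by rewrite ler_wpM2r ?mulr_ge0 ?invr_ge0 ?mulr_ge0 ?exprn_ge0// ler_wpM2r.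
  have -> : 7 ^+ d * n%:R ^+ d * d%:R * (2 * (n%:R ^+ d * n%:R ^+ 2)^-1) =
     4 * d%:R * 7 ^+ d * (2 * n%:R ^+ 2)^-1 :> R.
    by field; rewrite !expf_neq0 ?lt0r_neq0.
  rewrite ler_wpM2l ?mulr_ge0 ?exprn_ge0//.
  rewrite lef_pV2 ?posrE ?mulr_gt0 ?exprn_gt0//.
  by rewrite -!natrM -natrX -natrM ler_nat shifted_square_ge.
have [D [mD D0 Dsub]] := borel_cantelli_eventually mF FC.
exists D; split=> //; apply: subset_trans Dsub; apply: subsetC => t /= [M _ MP].
exists (M + N).+1 => // n /= Mn x y nx xy.
have [k Mk kE] : exists2 k, (M <= k)%N & n = (k + N).+1.
  exists (n.-1 - N)%N; first by rewrite leq_subRL; lia.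
  by rewrite subnK; lia.
have nF : ~ F k t by exact: MP.
rewrite leNgt; apply/negP => lt; apply: nF.
have lowF (b : bond d) : in_box n.+1 (bond_src b) ->
    omega (bond_src b) (bond_tgt b) t < n%:R `^ (- eps) -> F k t.
  case: b => z i /= zn zl; rewrite kE in zn zl.
  have [v zE] := box_siteP zn.
  rewrite /F (bigD1 (v, i))//=; left => /=.
  by rewrite /low/= -zE ltW.
have [[i b] yE] := neighborsP xy.
case: b yE; rewrite /step/= => yE.
  by apply: (lowF (x, i)); [exact: in_box_mono nx|rewrite /bond_tgt/= -yE].
apply: (lowF (y, i)) => /=.
  by rewrite yE; exact: (in_box_step (i, false) nx).
rewrite /bond_tgt/= {2}yE subrK.
by have [_ -> _] := omega_env t.
Qed.

End LowConductances.

(** * The heat kernel bound *)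

Theorem theorem1p4 (R : realType) (d : nat) (hd : (5 <= d)%N) :
  exists delta : R -> R,
    [/\ forall gamma, 0 < gamma -> 0 < delta gamma,
        delta gamma @[gamma --> +oo] --> (0 : R) &
        forall (gamma : R) (disp : measure_display) (T : measurableType disp)
          (Q : probability T R) (omega : site d -> site d -> {RV Q >-> R}),
          0 < gamma ->
          (forall t, environment (fun x y => omega x y t)) ->
          (forall x y t, omega x y t <= 1) ->
          iid (fun b : bond d => omega (bond_src b) (bond_tgt b)) ->
          (forall b : bond d,
            fine (Q [set t | omega (bond_src b) (bond_tgt b) t <= a])
              / a `^ gamma @[a --> 0^'+] --> (1 : R)) ->
          {ae Q, forall t,
            (limn_esup (fun n : nat =>
               ereal_sup (range (fun x : site d =>
                 lne (transition_n (fun y z => omega y z t) n 0 x)%:E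
                   / (ln n%:R)%:E)))
             <= (- (d%:R / 2) + delta gamma)%:E)%E}].
Proof.
have d0 : (0 < d)%N by exact: leq_trans hd.
exists (fun gamma => (2 * d + 3)%:R * ((d + 2)%:R / gamma)); split.
- move=> gamma g0; by rewrite mulr_gt0 ?divr_gt0// ltr0n addnS.
- under eq_fun do rewrite mulrA.
  exact: cvg_div_pinfty.
move=> gamma disp T Q omega g0 we w1 [_ wid] wtail.
set eps : R := (d + 2)%:R / gamma.
have eps0 : 0 < eps by rewrite divr_gt0// ltr0n addnS.
have dpos : 0 < d%:R :> R by rewrite ltr0n.
(* 4 eps > 1 gives (2d + 3) eps >= d/2, and the kernel is at most 1 *)
have [e4|e4] := leP (4 * eps) 1; last first.
  apply: filterE => t; apply: limn_esup_log_le.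
  near=> n => x; apply: le_trans (transition_n_le1 (we t) d0 n 0 x) _.
  rewrite -[leLHS](powRr0 n%:R) ler_powR//.
    by near: n; exact: nbhs_infty_ger.
  rewrite natrD natrM; nra.
apply: filterS (eventually_no_low_conductance d0 g0 we wid wtail) => t lowt.
apply: limn_esup_log_le.
pose k := (Num.truncn (d%:R / 2 / eps)).+1.
have ke : d%:R / 2 <= k%:R * eps.
  by rewrite -ler_pdivrMr// ltW// truncnS_gt.
have c0 : 0 < (24 * d%:R ^+ 4)^-1 :> R by rewrite invr_gt0 mulr_gt0 ?exprn_gt0.
have [M HM] := expR_beats_power (4 * d%:R) k c0.
near=> n => x.
have n2 : (2 <= n)%N by near: n; exact: nbhs_infty_ge.
have n1 : 1 <= n%:R :> R by rewrite ler1n ltnW.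
pose lam : R := n%:R `^ (- eps).
pose r := Num.truncn (n%:R `^ (2^-1 - 2 * eps) : R).
have lam01 : 0 < lam <= 1.
  rewrite powR_gt0 ?(lt_le_trans ltr01)//= -[leRHS](powRr0 n%:R).
  by rewrite ler_powR// oppr_le0 ltW.
have lowtn : forall y z, in_box n y -> neighbors y z -> lam <= omega y z t.
  by rewrite /lam; near: n; exact: lowt.
have := @box_heat_kernel_bound R d _ lam n r x _ _ d0 (we t)
  (fun x y => w1 x y t) lam01 lowtn erefl erefl.
move=> /le_trans; apply.
apply: (scale_bound (k := k) d0 n2 eps0 e4 erefl erefl erefl erefl ke).
- by near: n; exact: near_powR_ge.
- by apply: HM; near: n; exact: near_powR_ge.
Unshelve. all: end_near. Qed.
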